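(* DC3 implies neither DC2 nor DC$2\frac12$ on dendrites (in the sense of pairs), that is: (i) there exist a dendrite $X$ and a continuous map $f:X\to X$ such that $f$ has a DC3 pair but no DC2 pair; and (ii) there exist a dendrite $X$ and a continuous map $f:X\to X$ such that $f$ has a DC3 pair but no DC$2\frac12$ pair.
   Context: A dendrite is a locally connected continuum (compact connected metric space) containing no subset homeomorphic to the circle. Let $(X,d)$ be a compact metric space and $f:X\to X$ continuous. For $x,y\in X$ and $\delta>0$ put $$\Phi_{(f,x,y)}(\delta)=\liminf_{n\to\infty}\frac1n\#\{0\le k\le n: d(f^k(x),f^k(y))<\delta\},\qquad \Phi^*_{(f,x,y)}(\delta)=\limsup_{n\to\infty}\frac1n\#\{0\le k\le n: d(f^k(x),f^k(y))<\delta\},$$ and $\Phi_{(f,x,y)}(0)=\lim_{\delta\to0^+}\Phi_{(f,x,y)}(\delta)$, $\Phi^*_{(f,x,y)}(0)=\lim_{\delta\to0^+}\Phi^*_{(f,x,y)}(\delta)$. A pair $(x,y)\in X^2$ is a DC2 pair if $\Phi^*_{(f,x,y)}(\delta)=1$ for every $0<\delta\le \operatorname{diam}X$ and $\Phi_{(f,x,y)}(\epsilon)<1$ for some $0<\epsilon\le\operatorname{diam}X$. It is a DC$2\frac12$ pair if $\Phi_{(f,x,y)}(0)<\Phi^*_{(f,x,y)}(0)$. It is a DC3 pair if there are $0\le a<b\le\operatorname{diam}X$ such that $\Phi_{(f,x,y)}(\delta)<\Phi^*_{(f,x,y)}(\delta)$ for every $\delta\in(a,b)$. *)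

(* Defs.v *)
From HB Require Import structures.
From mathcomp Require Import all_boot all_order all_algebra.
From mathcomp Require Import all_classical all_reals all_analysis.

Set Implicit Arguments.
Unset Strict Implicit.
Unset Printing Implicit Defensive.

Import Order.TTheory GRing.Theory Num.Theory.
Import numFieldNormedType.Exports.

Local Open Scope classical_set_scope.
Local Open Scope ring_scope.

Definition homeomorphic (S T : topologicalType) : Prop :=
  exists (f : S -> T) (g : T -> S),
    [/\ continuous f, continuous g, cancel f g & cancel g f].

Definition circle (R : realType) : set (R * R) :=
  [set p | p.1 ^+ 2 + p.2 ^+ 2 = 1].

Definition locally_connected (T : topologicalType) : Prop :=
  forall (x : T) (U : set T), nbhs x U ->
    exists V : set T, [/\ open V, V x, connected V & V `<=` U].

(* The topologicalType on set_type A is the subspace topology. *)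
Definition dendrite (R : realType) (X : metricType R) : Prop :=
  [/\ compact [set: X], connected [set: X], locally_connected X
    & ~ exists A : set X, homeomorphic (set_type A) (set_type (@circle R))].

Definition diam (R : realType) (X : metricType R) : R :=
  sup [set mdist p.1 p.2 | p in [set: X * X]].

(* The count is over the n + 1 indices 0 <= k <= n, divided by n. At n = 0 the
   division gives 0, which does not affect lower and upper limits. *)
Definition close_freq (R : realType) (X : metricType R) (f : X -> X) (x y : X)
    (delta : R) (n : nat) : R :=
  #|[pred k : 'I_n.+1 | mdist (iter k f x) (iter k f y) < delta]|%:R / n%:R.

Definition Phi (R : realType) (X : metricType R) (f : X -> X) (x y : X)
    (delta : R) : R := limn_inf (close_freq f x y delta).

Definition Phi_star (R : realType) (X : metricType R) (f : X -> X) (x y : X)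
    (delta : R) : R := limn_sup (close_freq f x y delta).

(* The values at 0 are by convention the right limits at 0: Phi f x y 0 and
   Phi_star f x y 0 are 0, since no distance is < 0. *)
Definition Phi0 (R : realType) (X : metricType R) (f : X -> X) (x y : X) : R :=
  lim (Phi f x y delta @[delta --> 0^'+]).

Definition Phi_star0 (R : realType) (X : metricType R) (f : X -> X)
    (x y : X) : R := lim (Phi_star f x y delta @[delta --> 0^'+]).

Definition DC2_pair (R : realType) (X : metricType R) (f : X -> X)
    (x y : X) : Prop :=
  (forall delta : R, 0 < delta <= diam X -> Phi_star f x y delta = 1) /\
  (exists2 epsilon : R, 0 < epsilon <= diam X & Phi f x y epsilon < 1).

(* "2h" stands for two and a half. *)
Definition DC2h_pair (R : realType) (X : metricType R) (f : X -> X)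
    (x y : X) : Prop := Phi0 f x y < Phi_star0 f x y.

Definition DC3_pair (R : realType) (X : metricType R) (f : X -> X)
    (x y : X) : Prop :=
  exists a b : R, [/\ 0 <= a, a < b, b <= diam X &
    forall delta : R, a < delta < b -> Phi f x y delta < Phi_star f x y delta].

(* Main.v *)
Require Import Defs.
From HB Require Import structures.
From mathcomp Require Import all_boot all_order all_algebra.
From mathcomp Require Import all_classical all_reals all_analysis.
From mathcomp Require Import zify ring lra.

(** One system refutes both implications: every DC2 pair has upper frequency 1
    at small distances and lower frequency below 1 somewhere, so it is enough
    to have a DC3 pair while the frequency of times with distance < delta
    converges, for every pair of points and every delta in (0, 1).

    The space.  Let W be a set of words nat -> bool stable under dropping two
    letters.  Points are sequences v of reals in [-1, 1] such that v_(n+1) is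
    nonzero only if |v_n| = 1, and whose signs agree, on each initial segment,
    with those of some word of W.  This is a rooted binary tree with 0 as root:
    v walks along edge n as far as |v_n|, in the direction given by the sign of
    v_n, and enters edge n+1 only at the end of edge n; its ends are the
    +1/-1 sequences.  With the distance sup_n 2^-n |u_n - v_n| it is a dendrite
    ([wtree_dendrite]): it is closed in a product of segments, two points are
    joined by a path on which each coordinate runs between its end values
    ([link]), and for a <> b some continuous real function separates them and
    has a one-point fibre at an intermediate level ([wtree_sep]), whereas a
    circle meets such a level on both of its arcs ([no_circle]).  The shift by
    two letters is continuous, and every point that is not an end reaches the
    fixed point 0, so that only the ends have interesting dynamics.

    The words.  Letters are read in pairs (phase, type).  The type is constant
    along a word.  The phases of type false are odd(isqrt n), those of type
    true are the same corrected by odd(log_2 (isqrt n)); W consists of the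
    shifts of these two words.  The phase changes only at squares, so a limit
    of shifts has an eventually constant phase ([phase_limP]), and the times
    close to a change of phase have density zero.  Hence, for delta < 1, the
    closeness of two ends of the same type is decided up to density zero by the
    equality of their current phases, and its frequency converges to 1 (two
    shifts of the same word), to 1/2 (a shift against a constant, since the
    blocks [m^2, (m+1)^2) come in pairs with opposite phases, see
    [dens_half]), or to 0 or 1 (two constants); see [close_dens].  Ends of
    different types never come closer than 1, nor do an end and the root.

    The DC3 pair consists of the two words themselves.  Their distance is 1 or
    2 according to whether the phases agree, and they agree at time k exactly
    if floor(log_4 k) is even ([phase_agree]): the blocks [4^i, 4^(i+1)) are so
    long that the frequency of agreement oscillates ([leaf_DC3]). *)

Set Implicit Arguments.
Unset Strict Implicit.
Unset Printing Implicit Defensive.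

Import Order.TTheory GRing.Theory Num.Theory.
Import numFieldNormedType.Exports.

Local Open Scope classical_set_scope.
Local Open Scope ring_scope.

(** * The tree spanned by a set of words *)

Section WordTree.
Variables (R : realType) (W : set (nat -> bool)).

(** Position along each edge, counted with the sign of the letter: in these
    coordinates the shift of words extends to the tree as the shift of
    sequences. *)
Definition on_tree (v : nat -> R) : Prop :=
  [/\ forall n, `|v n| <= 1,
      forall n, v n.+1 != 0 -> `|v n| = 1 &
      forall n, exists2 w, W w & forall k, (k < n)%N -> 0 <= v k * (-1) ^+ w k].

Record wtree := WTree { coord :> nat -> R; coordP : on_tree coord }.

HB.instance Definition _ := gen_eqMixin wtree.
HB.instance Definition _ := gen_choiceMixin wtree.

Implicit Types u v : wtree.

Lemma wtree_ext u v : (forall k, u k = v k) -> u = v.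
Proof.
case: u v => [u pu] [v pv] /= uv; have e : u = v by apply/funext.
by move: pv; rewrite -e => pv; congr WTree; exact: Prop_irrelevance.
Qed.

Lemma coord_le1 (v : wtree) k : `|v k| <= 1.
Proof. by case: (coordP v). Qed.

Lemma coord_full (v : wtree) j : v j != 0 -> forall i, (i < j)%N -> `|v i| = 1.
Proof.
case: (coordP v) => _ full _; elim: j => // j IH vj i.
have vj1 := full _ vj; rewrite ltnS leq_eqVlt => /predU1P[->//|]; apply: IH.
by rewrite -normr_eq0 vj1 oner_neq0.
Qed.

Lemma coord_end (v : wtree) j :
  `|v j| != 1 -> forall i, (j < i)%N -> v i = 0.
Proof.
move=> vj i ji; apply: contraNeq vj => vi.
by apply/eqP; exact: coord_full ji.
Qed.

Definition wt (k : nat) : R := 2^-1 ^+ k.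

Lemma wt_gt0 k : 0 < wt k.
Proof. by rewrite exprn_gt0// invr_gt0. Qed.

Lemma wt_mono i k : (i <= k)%N -> wt k <= wt i.
Proof. by move=> ik; apply: ler_wiXn2l => //; lra. Qed.

Lemma wt_small (e : R) : 0 < e -> exists N, wt N < e.
Proof.
move=> e0; have /cvgrPdist_lt/(_ e e0)[N _ HN] :
    (fun n => (2^-1 : R) ^+ n) @ \oo --> (0 : R).
  by apply: cvg_expr; rewrite ger0_norm; lra.
exists N; have /= := HN N (leqnn N).
by rewrite sub0r normrN ger0_norm ?exprn_ge0 ?invr_ge0.
Qed.

Definition wdist (u v : wtree) : R :=
  sup [set wt k * `|u k - v k| | k in [set: nat]].

Lemma wt_diff_le2 (u v : wtree) k : wt k * `|u k - v k| <= wt k * 2.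
Proof.
apply: ler_wpM2l; first exact/ltW/wt_gt0.
by rewrite (le_trans (ler_normB _ _))// (_ : 2 = 1 + 1)// lerD ?coord_le1.
Qed.

Lemma wdist_has_sup u v :
  has_sup [set wt k * `|u k - v k| | k in [set: nat]].
Proof.
split; first by exists (wt 0 * `|u 0%N - v 0%N|), 0%N.
exists 2 => _ [k _ <-]; apply: le_trans (wt_diff_le2 u v k) _.
by rewrite -[leRHS]mul1r ler_wpM2r// (wt_mono (leq0n k)).
Qed.

Lemma coord_le_wdist u v k : wt k * `|u k - v k| <= wdist u v.
Proof. by apply: ub_le_sup; [case: (wdist_has_sup u v)|exists k]. Qed.

Lemma wdist_le u v c :
  (forall k, wt k * `|u k - v k| <= c) -> wdist u v <= c.
Proof.
move=> uvc; apply: ge_sup; first by case: (wdist_has_sup u v).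
by move=> _ [k _ <-].
Qed.

Lemma wdistxx u : wdist u u = 0.
Proof.
apply/eqP; rewrite eq_le; apply/andP; split.
  by apply: wdist_le => k; rewrite subrr normr0 mulr0.
by apply: le_trans (coord_le_wdist u u 0); rewrite subrr normr0 mulr0.
Qed.

Lemma wdist_eq0 u v : wdist u v = 0 -> u = v.
Proof.
move=> uv0; apply: wtree_ext => k; apply/eqP; rewrite -subr_eq0 -normr_le0.
by have := coord_le_wdist u v k; rewrite uv0 pmulr_rle0 ?wt_gt0.
Qed.

Lemma wdist_sym u v : wdist u v = wdist v u.
Proof. by congr sup; apply: eq_imagel => k _; rewrite distrC. Qed.

Lemma wdist_triangle v u w : wdist u w <= wdist u v + wdist v w.
Proof.
apply: wdist_le => k.
apply: le_trans (lerD (coord_le_wdist u v k) (coord_le_wdist v w k)).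
by rewrite -mulrDr ler_wpM2l ?ler_distD// ltW// wt_gt0.
Qed.

HB.instance Definition _ := isMetric.Build R wtree
  wdistxx wdist_eq0 wdist_sym wdist_triangle.

Lemma wcoord_continuous k : continuous (fun v : wtree => v k).
Proof.
move=> v; have FF := @nbhs_filter (wtree : topologicalType) v.
apply/(@cvgrPdist_lt _ _ _ _ FF) => e e0.
have := @nbhsx_ballx R wtree v _ (mulr_gt0 (wt_gt0 k) e0).
rewrite ballEmdist; apply: filterS => u /= uv.
rewrite -(ltr_pM2l (wt_gt0 k)); apply: le_lt_trans uv.
exact: coord_le_wdist.
Qed.

(** The tail of the supremum is small uniformly, because coordinates lie in
    [-1, 1]; hence the distance induces the topology of coordinatewise
    convergence. *)
Lemma wdist_lt_box (e : R) : 0 < e -> exists N, forall u v : wtree,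
  (forall k, (k < N)%N -> `|u k - v k| < e / 2) -> wdist u v < e.
Proof.
move=> e0; have e4 : 0 < e / 4 by rewrite divr_gt0.
have [N Ne] := wt_small e4; exists N => u v close.
apply: (@le_lt_trans _ _ (e / 2)); last by lra.
apply: wdist_le => k; have [kN|Nk] := ltnP k N.
  apply: le_trans (ltW (close k kN)).
  by rewrite -[leRHS]mul1r ler_wpM2r// (wt_mono (leq0n k)).
apply: le_trans (wt_diff_le2 _ _ k) _.
by have := wt_mono Nk; lra.
Qed.

Lemma wtree_cvg (T : Type) (F : set_system T) (FF : Filter F) (g : T -> wtree)
    (v : wtree) :
  (forall k, (fun t => g t k) @ F --> v k) -> g @ F --> v.
Proof.
move=> gv; apply/metricType_numDomainType.cvgrPdist_lt => e e0.
have e2 : 0 < e / 2 by rewrite divr_gt0.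
have [N close] := wdist_lt_box e0.
suff : \forall t \near F, forall k, (k < N)%N -> `|v k - g t k| < e / 2.
  by apply: filterS => t /close.
elim: N {close} => [|N IH]; first by apply: filterE => t k.
have /cvgrPdist_lt/(_ _ e2) := gv N.
move: IH; apply: filterS2 => t IH tN k; rewrite ltnS leq_eqVlt.
by move=> /predU1P[->//|]; exact: IH.
Qed.

Lemma wtree_continuous (T : topologicalType) (g : T -> wtree) :
  (forall k, continuous (fun t => g t k)) -> continuous g.
Proof. by move=> gc t; apply: wtree_cvg => k; exact: gc. Qed.

Lemma root_on_tree (w : nat -> bool) : W w -> on_tree (fun=> 0).
Proof.
move=> Ww; split=> [n|n|n]; first by rewrite normr0.
- by rewrite eqxx.
- by exists w => // k _; rewrite mul0r.
Qed.

Let ptwise : topologicalType := prod_topology (fun _ : nat => R).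

Lemma pcoord_continuous k : continuous (fun v : ptwise => v k : R).
Proof. exact: (@proj_continuous nat (fun=> R) k). Qed.

Let closed_preim (f : ptwise -> R) (D : set R) :
  continuous f -> closed D -> closed (f @^-1` D).
Proof. by move=> cf; apply: preimage_closed => v _; exact: cf. Qed.

Let closed_coord k (D : set R) :
  closed D -> closed [set v : ptwise | D (v k)].
Proof.
exact: (closed_preim (pcoord_continuous (k:=k))).
Qed.

Let closed_norm (D : set R) : closed D -> closed [set x : R | D `|x|].
Proof.
move=> cD; apply: (@preimage_closed R R (fun x : R => `|x|) D) => // x _.
exact: (@norm_continuous R R).
Qed.

(** Compatibility with W on an initial segment of length n only involves the
    finitely many patterns [g] of length n that occur in W, so it is a finite
    union of closed conditions even though W may be infinite. *)
Lemma on_tree_closed : closed [set v : ptwise | on_tree v].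
Proof.
pose good n (g : {ffun 'I_n -> bool}) :=
  exists2 w, W w & forall k : 'I_n, g k = w k.
have -> : [set v : ptwise | on_tree v] =
    \bigcap_n ([set v : ptwise | `|v n| <= 1]
      `&` ([set v : ptwise | v n.+1 = 0] `|` [set v : ptwise | `|v n| = 1])
      `&` \bigcup_(g in [set g | good n g])
           \bigcap_(k in [set: 'I_n]) [set v : ptwise | 0 <= v k * (-1) ^+ g k]).
  apply/seteqP; split=> [v [v1 vf vW] n _|v vn].
    split; first split => /=.
    - exact: v1.
    - by have [->|/vf->] := eqVneq (v n.+1) 0; [left|right].
    - have [w Ww vw] := vW n; exists [ffun k : 'I_n => w k].
        by exists w => // k; rewrite ffunE.
      by move=> k _ /=; rewrite ffunE; exact: vw.
  split=> n; have [[v1 vf] [g [w Ww gw] vg]] := vn n I => //.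
  - by move=> v0; case: vf => // v00; rewrite v00 eqxx in v0.
  - exists w => // k kn; have := vg (Ordinal kn) I.
    by rewrite /= gw.
apply: closed_bigI => n _; apply: closedI; first apply: closedI.
- exact: (closed_coord (closed_norm (@closed_le R 1))).
- apply: closedU; first exact: (closed_coord (@closed_eq R 0)).
  exact: (closed_coord (closed_norm (@closed_eq R 1))).
- apply: closed_bigcup; first exact: finite_finset.
  move=> g _; apply: closed_bigI => k _.
  apply: (@closed_coord k [set x | 0 <= x * (-1) ^+ g k]).
  apply: (@preimage_closed R R (fun x => x * (-1) ^+ g k) [set x | 0 <= x]).
    by move=> x _; exact: mulrr_continuous.
  exact: closed_ge.
Qed.

Lemma wtree_compact : W !=set0 -> compact [set: wtree].
Proof.
move=> [w Ww]; pose root := WTree (root_on_tree Ww).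
pose mk (v : ptwise) : wtree :=
  if pselect (on_tree v) is left p then WTree p else root.
have mkE (v : ptwise) (p : on_tree v) k : mk v k = v k :> R.
  by rewrite /mk; case: pselect.
have -> : [set: wtree] = mk @` [set v : ptwise | on_tree v].
  apply/seteqP; split=> // v _; exists (v : nat -> R); first exact: coordP.
  by apply: wtree_ext => k; rewrite mkE//; exact: coordP.
apply: continuous_compact.
  apply/subspace_continuousP => v pv; apply: wtree_cvg => k.
  suff vk x : x = v k :> R -> (fun t : ptwise => mk t k) @
      within [set v | on_tree v] (nbhs v) --> x by exact: (vk _ (mkE v pv k)).
  move=> ->.
  have vk : (fun t : ptwise => t k : R) @
      within [set v | on_tree v] (nbhs v) --> (v k : R).
    by apply: cvg_within_filter; exact: (pcoord_continuous (k:=k)).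
  apply: cvg_trans vk; apply: fmap_within_eq => u; rewrite inE => pu.
  by rewrite mkE.
apply: (subclosed_compact on_tree_closed
  (tychonoff (fun _ : nat => @segment_compact R (-1) 1))).
move=> v [v1 _ _] n /=; rewrite in_itv/= -ler_norml.
exact: v1.
Qed.

End WordTree.

(** * Paths in the tree *)

Section Clock.
Variable R : realType.

Lemma maxr0_continuous : continuous (fun x : R => Num.max 0 x).
Proof.
have -> : (fun x : R => Num.max 0 x) = (fun x => (x + `|x|) / 2).
  by apply/funext => x /=; case: (leP 0 x) => x0;
    [rewrite ger0_norm//|rewrite ltr0_norm//]; lra.
move=> x; apply: cvgMl; apply: cvgD; first exact: cvg_id.
exact: (@norm_continuous R R).
Qed.

(** As the time s decreases from 1 to 0, the clocks rise from 0 to 1 one after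
    the other: clock k moves during [2^-(k+1), 2^-k], when all earlier clocks
    show 1 and all later ones show 0.  Multiplying coordinate k by clock k
    therefore retracts a point towards the root while staying in the tree, and
    the whole journey takes bounded time even from an end. *)
Definition clock (k : nat) (s : R) : R :=
  Num.max 0 (1 - Num.max 0 (2 ^+ k.+1 * s - 1)).

Lemma clock_ge0 k s : 0 <= clock k s.
Proof. by rewrite /clock le_max lexx. Qed.

Lemma clock_le1 k s : clock k s <= 1.
Proof. by rewrite /clock ge_max ler01 gerBl le_max lexx. Qed.

Lemma clock_eq1 k s : 2 ^+ k.+1 * s <= 1 -> clock k s = 1.
Proof.
by move=> h; rewrite /clock [Num.max 0 (_ - 1)]max_l ?subr_le0// subr0 max_r.
Qed.

Lemma clock_eq0 k s : 2 <= 2 ^+ k.+1 * s -> clock k s = 0.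
Proof.
by move=> h; rewrite /clock max_l// [Num.max 0 _]max_r; lra.
Qed.

Lemma clock_lin k s : 1 <= 2 ^+ k.+1 * s <= 2 ->
  clock k s = 2 - 2 ^+ k.+1 * s.
Proof.
by move=> h; rewrite /clock [Num.max 0 (_ - 1)]max_r ?max_r; lra.
Qed.

Lemma clock_step k s : clock k.+1 s != 0 -> clock k s = 1.
Proof.
move=> h; apply: clock_eq1; rewrite leNgt; apply: contra h => h.
apply/eqP/clock_eq0.
by move: h; rewrite [2 ^+ k.+2]exprS -mulrA; lra.
Qed.

Lemma clock0 k : clock k 0 = 1.
Proof. by apply: clock_eq1; rewrite mulr0. Qed.

Lemma clock_continuous k : continuous (clock k).
Proof.
pose relu (x : R) := Num.max 0 x.
have Cr : continuous relu by exact: maxr0_continuous.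
have C1 : continuous (fun s : R => 2 ^+ k.+1 * s - 1).
  by move=> s; apply: cvgB; [exact: mulrl_continuous|exact: cvg_cst].
have C2 : continuous (fun x : R => 1 - relu x).
  by move=> x; apply: cvgB; [exact: cvg_cst|exact: Cr].
move=> s; apply: (@continuous_comp _ _ _
    ((fun x : R => 1 - relu x) \o (fun s : R => 2 ^+ k.+1 * s - 1)) relu).
  by apply: continuous_comp; [exact: C1|exact: C2].
exact: Cr.
Qed.

Lemma clock_at j (c : R) : 0 <= c <= 1 -> exists s : R,
  [/\ 0 <= s, clock j s = c, forall k, (j < k)%N -> clock k s = 0 &
    forall t, 0 <= t <= s ->
      c <= clock j t /\ forall k, (k < j)%N -> clock k t = 1].
Proof.
move=> /andP[c0 c1]; have p0 : 0 < (2 : R) ^+ j.+1 by rewrite exprn_gt0.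
have cs : (2 : R) ^+ j.+1 * ((2 - c) / 2 ^+ j.+1) = 2 - c.
  by rewrite mulrC divfK// gt_eqF.
exists ((2 - c) / 2 ^+ j.+1); split.
- by rewrite divr_ge0 ?ltW//; lra.
- by rewrite clock_lin cs; lra.
- move=> k jk; apply: clock_eq0.
  rewrite (_ : k.+1 = (k - j) + j.+1)%N; last by lia.
  rewrite exprD -mulrA cs -(subnSK jk) exprS.
  have : 1 <= (2 : R) ^+ (k - j.+1) by rewrite exprn_ege1//; lra.
  by nra.
- move=> t /andP[t0]; rewrite ler_pdivlMr// mulrC => ts; split.
    have [h|h] := leP (2 ^+ j.+1 * t) 1; first by rewrite clock_eq1.
    by rewrite clock_lin; lra.
  move=> k kj; apply: clock_eq1.
  have : 2 ^+ k.+2 * t <= 2 ^+ j.+1 * t.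
    by rewrite ler_wpM2r// ler_weXn2l//; lra.
  by rewrite [2 ^+ k.+2]exprS -mulrA; lra.
Qed.

End Clock.

Lemma normB_opp (R : realDomainType) (a b : R) :
  a * b <= 0 -> `|a - b| = `|a| + `|b|.
Proof.
case: (ltrgt0P a) => [a0|a0|->] ab.
- have b0 : b <= 0 by rewrite -(pmulr_rle0 _ a0).
  by rewrite ger0_norm ?ler0_norm// ?subr_ge0 ?(le_trans b0)// ltW.
- have b0 : 0 <= b by rewrite -(nmulr_rle0 _ a0).
  by rewrite ltr0_norm ?ger0_norm// ?subr_lt0 ?(lt_le_trans a0)// opprB addrC.
- by rewrite sub0r normrN add0r.
Qed.


Section Connect.
Variables (R : realType) (W : set (nat -> bool)).
Implicit Types u v : wtree R W.

Lemma prune_on_tree v s : on_tree W (fun k => v k * clock k s).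
Proof.
split=> [n|n|n].
- rewrite normrM mulr_ile1 ?coord_le1//.
  by rewrite ger0_norm ?clock_ge0// clock_le1.
- rewrite mulf_eq0 negb_or => /andP[vn /clock_step->].
  by rewrite mulr1; exact: (coord_full vn).
- case: (coordP v) => _ _ /(_ n)[w Ww vw]; exists w => // k kn.
  by rewrite mulrAC mulr_ge0 ?clock_ge0// vw.
Qed.

Definition prune v s : wtree R W := WTree (prune_on_tree v s).

Lemma prune_connected v s : connected (prune v @` `[0, s]).
Proof.
apply: connected_continuous_connected; first exact: segment_connected.
apply: continuous_subspaceT; apply: wtree_continuous => k t.
by apply: cvgMr; exact: clock_continuous.
Qed.

Lemma prune_start v s : 0 <= s -> (prune v @` `[0, s]) v.
Proof.
move=> s0; exists 0; first by rewrite /= in_itv/= lexx.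
by apply: wtree_ext => k /=; rewrite clock0 mulr1.
Qed.

(** The path goes from u down to the meeting point of the two branches and
    up again to v; the meeting point is u or v itself if one lies below the
    other.  Moving along it, no coordinate gets farther from its value at v than
    it is at u: the coordinates before the index j where u and v part do not
    change, and if u and v differ by less than 1 at j, then at most one of them
    continues beyond j, so that each later coordinate moves monotonically from
    or to 0. *)
Lemma link u v : exists C : set (wtree R W),
  [/\ connected C, C u, C v & forall N,
    (forall k, (k < N)%N -> `|u k - v k| < 1) ->
    forall p, C p -> forall k, (k < N)%N -> `|p k - v k| <= `|u k - v k|].
Proof.
have [<-|uv] := eqVneq u v.
  exists [set u]; split=> //; first exact: connected1.
  by move=> N _ p ->.
have : exists k, u k != v k.
  apply: contra_notP (negP uv) => h; apply/eqP/wtree_ext => k.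
  by apply/eqP/negPn/negP => ne; apply: h; exists k.
move=> /ex_minnP[j uvj jmin].
have eqj k : (k < j)%N -> u k = v k.
  by move=> kj; apply/eqP/negPn/negP => /jmin; rewrite leqNgt kj.
(* a path inside one branch, from the farther point [y] down to the nearer
   point [x], when the j-th coordinates have the same sign *)
have below (x y : wtree R W) : (forall k, (k < j)%N -> x k = y k) ->
    0 < x j * y j -> `|x j| < `|y j| ->
  exists s, [/\ 0 <= s, prune y s = x & forall t, 0 <= t <= s ->
    [/\ forall k, (k < j)%N -> y k * clock k t = y k,
        `|y j * clock j t - x j| <= `|y j - x j|,
        `|y j - y j * clock j t| <= `|y j - x j| &
        forall k, (j < k)%N -> x k = 0]].
  move=> xy xyj xj.
  have yj0 : 0 < `|y j| by exact: le_lt_trans xj.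
  have c01 : 0 <= `|x j| / `|y j| <= 1.
    by rewrite divr_ge0//= ler_pdivrMr// mul1r ltW.
  have xend k : (j < k)%N -> x k = 0.
    apply: coord_end; apply: contraTneq xj => ->.
    by rewrite -leNgt coord_le1.
  have xjE : y j * (`|x j| / `|y j|) = x j.
    have yj0' : y j != 0 by rewrite -normr_gt0.
    case: (ltrgt0P (y j)) xyj yj0' => [y0|y0|->]; rewrite ?eqxx//.
      rewrite pmulr_lgt0// => x0 _; rewrite !gtr0_norm//.
      by rewrite mulrCA divff ?mulr1// gt_eqF.
    rewrite nmulr_lgt0// => x0 _; rewrite !ltr0_norm// invrN mulrNN.
    by rewrite mulrCA divff ?mulr1// lt_eqF.
  move: (`|x j| / `|y j|) c01 xjE => q q01 xjE.
  have [s [s0 sj send st]] := clock_at j q01.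
  exists s; split=> //.
    apply: wtree_ext => k /=; have [kj|jk|->] := ltngtP k j.
    - have [|_ ->//] := st s; first by rewrite s0 lexx.
      by rewrite mulr1 xy.
    - by rewrite send// mulr0 xend.
    - by rewrite sj.
  move=> t /st[ct kt]; have cj1 := clock_le1 j t.
  case/andP: q01 => q0 q1; split=> //.
  - by move=> k /kt->; rewrite mulr1.
  - rewrite -xjE -[X in _ <= `|X - _|]mulr1 -!mulrBr.
    by rewrite !normrM ler_wpM2l// !ger0_norm; lra.
  - rewrite -xjE -[X in `|X - _| <= _]mulr1 -[X in _ <= `|X - _|]mulr1.
    by rewrite -!mulrBr !normrM ler_wpM2l// !ger0_norm; lra.
(* Equal signs: one of u, v lies below the other.  Opposite signs, or a zero:
   the branches part at the beginning of edge j. *)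
have [uvpos|uvneg] := ltP 0 (u j * v j).
  have := uvj; rewrite -subr_eq0 => uvj'.
  have : `|u j| != `|v j|.
    apply: contra uvj => /eqP e.
    case: (ltrgt0P (v j)) e uvpos => [v0|v0|->]; last by rewrite mulr0 ltxx.
      by rewrite pmulr_lgt0// => + u0; rewrite gtr0_norm// => ->.
    by rewrite nmulr_lgt0// => + u0; rewrite ltr0_norm// => /oppr_inj->.
  rewrite neq_lt => /orP[lt|lt].
    have [s [s0 us st]] := below u v eqj uvpos lt.
    exists (prune v @` `[0, s]); split.
    - exact: prune_connected.
    - by exists s => //; rewrite /= in_itv/= s0 lexx.
    - exact: prune_start.
    - move=> N _ p [t /=]; rewrite in_itv/= => /st[t1 t2 t3 t4] <- k _ /=.
      have [kj|jk|->] := ltngtP k j.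
      + by rewrite t1// subrr normr0.
      + rewrite t4// sub0r normrN -[X in _ - X]mulr1 -mulrBr normrM.
        rewrite ler_piMr// distrC ger0_norm ?subr_ge0 ?clock_le1//.
        by rewrite gerBl clock_ge0.
      + by rewrite distrC [leRHS]distrC.
  have vu k : (k < j)%N -> v k = u k by move/eqj.
  rewrite mulrC in uvpos.
  have [s [s0 us st]] := below v u vu uvpos lt.
  exists (prune u @` `[0, s]); split.
  - exact: prune_connected.
  - exact: prune_start.
  - by exists s => //; rewrite /= in_itv/= s0 lexx.
  - move=> N _ p [t /=]; rewrite in_itv/= => /st[t1 t2 t3 t4] <- k _ /=.
    have [kj|jk|->//] := ltngtP k j.
    + by rewrite t1// eqj// subrr normr0.
    + rewrite t4// !subr0 normrM ler_piMr// ger0_norm ?clock_ge0//.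
      exact: clock_le1.
have [|s [s0 sj send st]] := @clock_at R j 0; first by rewrite lexx ler01.
have meet : prune u s = prune v s.
  apply: wtree_ext => k /=; have [kj|jk|->] := ltngtP k j.
  - by rewrite eqj.
  - by rewrite send// !mulr0.
  - by rewrite sj !mulr0.
exists (prune u @` `[0, s] `|` prune v @` `[0, s]); split.
- apply: connectedU; [|exact: prune_connected|exact: prune_connected].
  exists (prune u s); split; first by exists s => //=; rewrite in_itv/= s0 lexx.
  by rewrite meet; exists s => //=; rewrite in_itv/= s0 lexx.
- by left; exact: prune_start.
- by right; exact: prune_start.
- move=> N close p Cp k kN.
  have [t [t0s pE]] : exists t, 0 <= t <= s /\
      (p k = u k * clock k t \/ p k = v k * clock k t).
    by case: Cp => -[t /=]; rewrite in_itv/= => t0s <-; exists t;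
      split=> //; [left|right].
  have [_ kt] := st t t0s.
  have c0 := clock_ge0 k t; have c1 := clock_le1 k t.
  have [kj|jk|kj] := ltngtP k j.
  + by case: pE => ->; rewrite kt// mulr1 ?subrr ?normr0.
  + have := close j (ltn_trans jk kN) => cj.
    have uj : `|u j| != 1.
      by rewrite neq_lt (le_lt_trans _ cj)// normB_opp// lerDl.
    have vj : `|v j| != 1.
      by rewrite neq_lt (le_lt_trans _ cj)// normB_opp// lerDr.
    by case: pE => ->; rewrite (coord_end uj jk) (coord_end vj jk) mul0r.
  + subst k; rewrite [leRHS]normB_opp//; case: pE => ->.
      apply: le_trans (ler_normB _ _) _; rewrite lerD2r normrM ler_piMr//.
      by rewrite ger0_norm.
    rewrite -[X in _ - X]mulr1 -mulrBr normrM.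
    apply: le_trans (_ : `|v j| <= _); last by rewrite lerDr.
    by rewrite ler_piMr// distrC ger0_norm ?subr_ge0 ?gerBl.
Qed.

Lemma wtree_connected : W !=set0 -> connected [set: wtree R W].
Proof.
move=> [w Ww]; pose root := WTree (root_on_tree R Ww).
pose A u := projT1 (cid (link u root)).
have -> : [set: wtree R W] = \bigcup_(u in [set: wtree R W]) A u.
  apply/seteqP; split=> // u _; exists u => //.
  by rewrite /A; case: cid => C /= [].
apply: bigcup_connected.
  by exists root => u _; rewrite /A; case: cid => C /= [].
by move=> u _; rewrite /A; case: cid => C /= [].
Qed.

Definition box v N (e : R) : set (wtree R W) :=
  [set u : wtree R W | forall k, (k < N)%N -> `|u k - v k| < e].

Lemma box_open v N (e : R) : open (box v N e).
Proof.
elim: N => [|N IH].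
  by rewrite (_ : box v 0 e = setT); [exact: openT|apply/seteqP; split].
have -> : box v N.+1 e =
    box v N e `&` (fun u : wtree R W => u N) @^-1` ball (v N) e.
  apply/seteqP; split=> u.
    move=> h; split=> [k kN|]; first by apply: h; exact: ltnW.
    by rewrite /= /ball/= distrC; exact: h.
  move=> [h hN] k; rewrite ltnS leq_eqVlt => /predU1P[->|]; last exact: h.
  by rewrite distrC.
apply: openI => //; apply: open_comp; last exact: ball_open.
by move=> u _; exact: wcoord_continuous.
Qed.

(** By [link], every point of such a box is joined to the centre inside the
    box. *)
Lemma box_connected v N (e : R) : 0 < e -> e <= 1 -> connected (box v N e).
Proof.
move=> e0 e1; pose A u := projT1 (cid (link u v)).
have AP u : box v N e u ->
    [/\ connected (A u), A u u, A u v & A u `<=` box v N e].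
  rewrite /A; case: cid => C /= [Cc Cu Cv Cb] bu; split=> // p Cp k kN.
  apply: le_lt_trans (bu k kN); apply: Cb kN => // i iN.
  by apply: lt_le_trans e1; exact: bu.
have -> : box v N e = \bigcup_(u in box v N e) A u.
  apply/seteqP; split=> [u bu|p [u /AP[_ _ _]]]; last exact.
  by exists u => //; case: (AP u bu).
apply: bigcup_connected; first by exists v => u /AP[].
by move=> u /AP[].
Qed.

Lemma wtree_locally_connected : locally_connected (wtree R W).
Proof.
move=> v U; rewrite -nbhs_ballE => -[e /= e0 eU].
have [N close] := wdist_lt_box W e0.
have m0 : 0 < Num.min 1 (e / 2) by rewrite lt_min ltr01/= divr_gt0.
exists (box v N (Num.min 1 (e / 2))); split.
- exact: box_open.
- by move=> k _; rewrite subrr normr0.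
- by apply: box_connected => //; rewrite ge_min lexx.
- move=> u bu; apply: eU; rewrite ballEmdist /=; apply: close => k kN.
  by rewrite distrC; apply: lt_le_trans (bu k kN) _; rewrite ge_min lexx orbT.
Qed.

End Connect.

(** * Circles *)

Section NoCircle.
Variable R : realType.

(** Stereographic parametrization: for t in [-1, 1] this runs through the right
    ([sg = false]) or left ([sg = true]) half circle, and the two halves share
    exactly the end points t = -1 and t = 1. *)
Let arc_on_circle (sg : bool) (t : R) :
  ((-1) ^+ sg * (1 - t ^+ 2) / (1 + t ^+ 2), 2 * t / (1 + t ^+ 2))
    \in @circle R.
Proof.
have d0 : 1 + t ^+ 2 != 0 by rewrite gt_eqF// ltr_wpDr// sqr_ge0.
rewrite inE /circle/= !exprMn exprAC sqrrN !expr1n.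
by field.
Qed.

Let arc sg t : set_type (@circle R) := SigSub (arc_on_circle sg t).

Let arc_continuous sg : continuous (arc sg).
Proof.
have d0 (t : R) : 1 + t ^+ 2 != 0 by rewrite gt_eqF// ltr_wpDr// sqr_ge0.
have sq : continuous (fun t : R => 1 + t ^+ 2).
  by move=> t; apply: cvgD; [exact: cvg_cst|exact: exprn_continuous].
have inv : continuous (fun t : R => (1 + t ^+ 2)^-1).
  by move=> t; exact: (cvgV (d0 t) (sq t)).
have c1 : continuous (fun t : R => (-1) ^+ sg * (1 - t ^+ 2) / (1 + t ^+ 2)).
  move=> t; apply: cvgM; last exact: inv.
  apply: cvgMr; apply: cvgB; [exact: cvg_cst|exact: exprn_continuous].
have c2 : continuous (fun t : R => 2 * t / (1 + t ^+ 2)).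
  move=> t; apply: cvgM; last exact: inv.
  exact: mulrl_continuous.
have c12 : continuous (fun t : R =>
    ((-1) ^+ sg * (1 - t ^+ 2) / (1 + t ^+ 2), 2 * t / (1 + t ^+ 2))).
  by move=> t; exact: (cvg_pair (c1 t) (c2 t)).
exact: continuous_comp_initial.
Qed.

(** By the intermediate value theorem phi takes the value tau on both halves of
    an embedded circle through the images a, b of the two poles.  The one-point
    fibre forces the two preimages to coincide, so they are poles, where the
    value of phi is phi a or phi b and not tau. *)
Lemma no_circle (X : topologicalType) :
  (forall a b : X, a <> b -> exists (phi : X -> R) (tau : R),
     [/\ continuous phi,
         Num.min (phi a) (phi b) < tau < Num.max (phi a) (phi b) &
         forall p q, phi p = tau -> phi q = tau -> p = q]) ->
  ~ exists A : set X, homeomorphic (set_type A) (set_type (@circle R)).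
Proof.
move=> sep [A [f [g [_ gc _ gK]]]].
pose c sg t : X := set_val (g (arc sg t)).
have cc sg : continuous (c sg).
  move=> t; apply: (@continuous_comp _ _ _ (g \o arc sg) set_val).
    by apply: continuous_comp; [exact: arc_continuous|exact: gc].
  exact: initial_continuous.
have arcE t : t ^+ 2 = 1 -> arc false t = arc true t.
  by move=> t1; apply: val_inj; rewrite /= t1 subrr !mulr0.
have cE t : t ^+ 2 = 1 -> c false t = c true t.
  by move=> /arcE; rewrite /c => ->.
have cinj sg sg' t t' : c sg t = c sg' t' -> arc sg t = arc sg' t'.
  by move=> /val_inj/(congr1 f); rewrite !gK.
have [|phi [tau [phic /andP[lo hi] fib]]] := sep (c false (-1)) (c false 1).
  move=> /cinj/(congr1 val)[_]; rewrite sqrrN expr1n -mulr2n.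
  lra.
have hit sg : exists2 t, t \in `[(-1 : R), 1] & phi (c sg t) = tau.
  apply: (@IVT _ (phi \o c sg)); first by lra.
    apply: continuous_subspaceT => t.
    by apply: continuous_comp; [exact: cc|exact: phic].
  case: sg; rewrite /= -?cE ?sqrrN ?expr1n//; by rewrite !ltW.
have [t t1 tE] := hit false; have [t' t1' tE'] := hit true.
have /cinj/(congr1 val)[e _] := fib _ _ tE tE'.
have t2 : t ^+ 2 = 1.
  move: t1 t1' e; rewrite !in_itv/= => t1 t1'.
  rewrite expr0 expr1 mul1r mulN1r.
  have d (x : R) : 0 < 1 + x ^+ 2 by rewrite ltr_wpDr// sqr_ge0.
  have p (x : R) : -1 <= x <= 1 -> 0 <= (1 - x ^+ 2) / (1 + x ^+ 2).
    move=> x1; apply: divr_ge0; last exact: ltW.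
    by rewrite subr_ge0; nra.
  move: (p t t1) (p t' t1'); rewrite mulNr => p1 p2 e.
  have : (1 - t ^+ 2) / (1 + t ^+ 2) = 0 by lra.
  move/eqP; rewrite mulf_eq0 invr_eq0 (gt_eqF (d t)) orbF subr_eq0.
  by move/eqP.
have /pred2P[tt|tt] : (t == 1) || (t == -1).
- by rewrite -sqrf_eq1; apply/eqP.
- move: lo hi; rewrite -tE tt gt_min lt_max ltxx !orbF => lo hi.
  by have := lt_trans lo hi; rewrite ltxx.
- move: lo hi; rewrite -tE tt gt_min lt_max ltxx /= => lo hi.
  by have := lt_trans lo hi; rewrite ltxx.
Qed.

End NoCircle.

Lemma branch_fun_continuous (R : realType) (X : topologicalType)
    (c : nat -> X -> R) (a : nat -> R) (j : nat) :
  (forall k, continuous (c k)) ->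
  continuous (fun x => c j x * \prod_(i < j) Num.max 0 (c i x * a i)).
Proof.
move=> cc; pose relu (x : R) := Num.max 0 x.
have rterm i : continuous (fun x => relu (c i x * a i)).
  move=> x; apply: (@continuous_comp _ _ _ (fun x => c i x * a i) relu).
    by apply: cvgMl; exact: cc.
  exact: maxr0_continuous.
have prod n : continuous (fun x => \prod_(i < n) relu (c i x * a i)).
  elim: n => [|n IH] x; rewrite /continuous_at.
    by under eq_cvg do rewrite big_ord0; rewrite big_ord0; exact: cvg_cst.
  under eq_cvg do rewrite big_ord_recr; rewrite big_ord_recr.
  by apply: cvgM; [exact: IH|exact: rterm].
by move=> x; apply: cvgM; [exact: cc|exact: prod].
Qed.

Section Dendrite.
Variables (R : realType) (W : set (nat -> bool)).
Implicit Types u v : wtree R W.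

(** If a and b part at coordinate j, the function phi reads the position on
    edge j for the points of their common branch and vanishes at all others; at
    a level tau other than -1, 0, 1 the fibre is one point inside that edge. *)
Lemma wtree_sep (a b : wtree R W) : a <> b ->
  exists (phi : wtree R W -> R) (tau : R), [/\ continuous phi,
    Num.min (phi a) (phi b) < tau < Num.max (phi a) (phi b) &
    forall p q, phi p = tau -> phi q = tau -> p = q].
Proof.
move=> ab; have : exists k, a k != b k.
  apply: contra_notP ab => h; apply/wtree_ext => k.
  by apply/eqP/negPn/negP => ne; apply: h; exists k.
move=> /ex_minnP[j abj jmin].
have eqj k : (k < j)%N -> a k = b k.
  by move=> kj; apply/eqP/negPn/negP => /jmin; rewrite leqNgt kj.
have aj1 k : (k < j)%N -> `|a k| = 1.
  have [aj0|/coord_full] := eqVneq (a j) 0; last exact.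
  by move=> kj; rewrite eqj//; apply: coord_full kj; rewrite -aj0 eq_sym.
(* On the tree the product is 1 or 0 as soon as v j != 0, according to whether
   v has the same initial coordinates as a. *)
pose phi v := v j * \prod_(i < j) Num.max 0 (v i * a i).
have prefix v : (forall k, (k < j)%N -> v k = a k) -> phi v = v j.
  move=> va; rewrite /phi big1 ?mulr1// => i _.
  by rewrite va// -expr2 -real_normK ?num_real// aj1// expr1n max_r.
have phi_prefix v : phi v != 0 -> forall k, (k < j)%N -> v k = a k.
  rewrite mulf_eq0 negb_or => /andP[vj pr] k kj.
  have vk := coord_full vj kj.
  have : Num.max 0 (v k * a k) != 0.
    by apply: contra pr => /eqP e; apply/prodf_eq0; exists (Ordinal kj) => //;
      rewrite e.
  have := aj1 k kj; have := vk.
  case: (ltrgt0P (v k)) => [_|_|_]; case: (ltrgt0P (a k)) => [_|_|_];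
    move=> h1 h2; try lra.
  - by rewrite h1 -[a k]opprK h2 mulrN1 max_l ?eqxx// lerN10.
  - by rewrite -[v k]opprK h1 h2 mulr1 max_l ?eqxx// lerN10.
have phic : continuous phi.
  apply: (@branch_fun_continuous _ _ (fun k v => v k)) => k.
  exact: wcoord_continuous.
have [tau [tau0 tau1 /andP[lo hi]]] : exists tau : R, [/\ tau != 0, `|tau| < 1 &
    Num.min (a j) (b j) < tau < Num.max (a j) (b j)].
  have := coord_le1 a j; have := coord_le1 b j; rewrite !ler_norml => b1 a1.
  suff [tau [tau0 /andP[lo hi]]] : exists tau : R, tau != 0 /\
      Num.min (a j) (b j) < tau < Num.max (a j) (b j).
    exists tau; split=> //; last by rewrite lo.
    move: lo hi; rewrite lt_max gt_min ltr_norml; lra.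
  have between (x y : R) : x < y -> exists tau : R, tau != 0 /\ x < tau < y.
    move=> xy; have [xy0|xy0] := eqVneq (x + y) 0.
      by exists (x / 2); split; [apply/eqP|]; lra.
    exists ((x + y) / 2); split; last by lra.
    by apply: contra_neq xy0 => h; lra.
  move: abj; rewrite neq_lt => /orP[] lt; have le := ltW lt.
    by rewrite min_l ?max_r//; exact: between.
  by rewrite min_r ?max_l//; exact: between.
exists phi, tau; split=> //.
  by rewrite !prefix ?lo//; move=> k /eqj.
move=> p q pt qt.
have Hp : phi p != 0 by rewrite pt.
have Hq : phi q != 0 by rewrite qt.
have pj := pt; rewrite (prefix p (phi_prefix p Hp)) in pj.
have qj := qt; rewrite (prefix q (phi_prefix q Hq)) in qj.
apply: wtree_ext => k; have [kj|jk|->] := ltngtP k j.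
- by rewrite (phi_prefix p Hp)// (phi_prefix q Hq).
- rewrite (@coord_end _ _ p j)//; last by rewrite pj lt_eqF.
  by rewrite (@coord_end _ _ q j)//; rewrite qj lt_eqF.
- by rewrite pj qj.
Qed.

Theorem wtree_dendrite : W !=set0 -> dendrite (wtree R W).
Proof.
move=> W0; split.
- exact: wtree_compact.
- exact: wtree_connected.
- exact: wtree_locally_connected.
- exact: no_circle wtree_sep.
Qed.

End Dendrite.

(** * Densities of sets of natural numbers *)

Section Slow.
Local Open Scope nat_scope.

(** Sublinear growth, e n = o(n), stated without division. *)
Definition slow (e : nat -> nat) :=
  forall K, exists C, forall n, K * e n <= C + n.

Lemma slow_le e e' : (forall n, e n <= e' n) -> slow e' -> slow e.
Proof.
move=> ee' se' K; have [C HC] := se' K; exists C => n.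
by apply: leq_trans (HC n); rewrite leq_mul2l ee' orbT.
Qed.

Lemma slow_add e e' : slow e -> slow e' -> slow (fun n => e n + e' n).
Proof.
move=> se se' K; have [C HC] := se (2 * K); have [C' HC'] := se' (2 * K).
by exists (C + C') => n; have := HC n; have := HC' n; nia.
Qed.

Lemma slow_mul c e : slow e -> slow (fun n => c * e n).
Proof.
by move=> se K; have [C HC] := se (K * c); exists C => n; rewrite mulnA.
Qed.

Lemma slow_cst c : slow (fun=> c).
Proof. by move=> K; exists (K * c) => n; rewrite leq_addr. Qed.

Lemma slow_shift c e : slow e -> slow (fun n => e (n + c)).
Proof.
move=> se K; have [C HC] := se K; exists (C + c) => n.
by have := HC (n + c); lia.
Qed.

Definition cnt (E : pred nat) n := \sum_(k < n) (E k : nat).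

Lemma cntS E n : cnt E n.+1 = cnt E n + E n.
Proof. by rewrite /cnt big_ord_recr. Qed.

Lemma cnt0 E : cnt E 0 = 0. Proof. by rewrite /cnt big_ord0. Qed.

Lemma cnt_le E n : cnt E n <= n.
Proof. by elim: n => [|n IH]; rewrite ?cnt0// cntS -addn1 leq_add ?leq_b1. Qed.

Lemma cnt_mono E m n : m <= n -> cnt E m <= cnt E n <= cnt E m + (n - m).
Proof.
elim: n => [|n IH]; first by rewrite leqn0 => /eqP->; rewrite cnt0.
rewrite leq_eqVlt => /predU1P[->|]; first by lia.
rewrite ltnS => mn; have {IH} := IH mn; rewrite cntS subSn// => /andP[h1 h2].
by case: (E n) => /=; apply/andP; split; lia.
Qed.

Lemma cnt_cst E (b : bool) m r :
  (forall k, m <= k < m + r -> E k = b) -> cnt E (m + r) = cnt E m + r * b.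
Proof.
elim: r => [|r IH] h; first by rewrite !addn0.
rewrite addnS cntS IH; last by move=> k kr; apply: h; lia.
by rewrite h; lia.
Qed.

Lemma cnt_shift E c n : cnt (fun k => E (k + c)) n + cnt E c = cnt E (n + c).
Proof.
by elim: n => [|n IH]; rewrite ?cnt0// addSn !cntS addnAC IH.
Qed.

Implicit Types E : pred nat.

Definition null E := slow (cnt E).

Lemma cnt_sub E (E' : pred nat) n :
  (forall k, E k -> E' k) -> cnt E n <= cnt E' n.
Proof.
move=> EE'; elim: n => [|n IH]; rewrite ?cnt0// !cntS leq_add//.
by case: (E n) (EE' n) => // ->.
Qed.

Lemma null_sub E (E' : pred nat) : (forall k, E k -> E' k) -> null E' -> null E.
Proof. by move=> EE'; apply: slow_le => n; exact: cnt_sub. Qed.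

Lemma null_or E (E' : pred nat) :
  null E -> null E' -> null (fun k => E k || E' k).
Proof.
move=> nE nE'; apply: slow_le (slow_add nE nE').
by elim=> [|n IH]; rewrite ?cnt0// !cntS; case: (E n); case: (E' n) => /=; lia.
Qed.

Lemma null_shift c E : null E -> null (fun k => E (k + c)).
Proof.
move=> nE; apply: slow_le (slow_shift c nE) => n.
by rewrite -cnt_shift leq_addr.
Qed.

Lemma null_xpred0 : null xpred0.
Proof.
by apply: slow_le (slow_cst 0); elim=> [|n IH]; rewrite ?cnt0// cntS addn0.
Qed.

(** The density of E is a/b: the two truncated differences add up to
    |b * cnt E n - a * n|. *)
Definition dens a b E :=
  slow (fun n => (b * cnt E n - a * n) + (a * n - b * cnt E n)).

Lemma dens_close a b E (E' : pred nat) e : slow e ->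
  (forall n, cnt E n <= cnt E' n + e n) ->
  (forall n, cnt E' n <= cnt E n + e n) ->
  dens a b E -> dens a b E'.
Proof.
move=> se h h' dE; apply: slow_le (slow_add dE (slow_mul b se)) => n.
have : b * cnt E n <= b * (cnt E' n + e n) by rewrite leq_mul2l h orbT.
have : b * cnt E' n <= b * (cnt E n + e n) by rewrite leq_mul2l h' orbT.
rewrite !mulnDr; lia.
Qed.

Lemma dens_null a b E (E' : pred nat) :
  null (fun k => E k != E' k) -> dens a b E -> dens a b E'.
Proof.
by move=> nE; apply: (dens_close nE); elim=> [|n IH]; rewrite ?cnt0// !cntS;
  case: (E n); case: (E' n) => /=; lia.
Qed.

Lemma dens_shift c a b E : dens a b E -> dens a b (fun k => E (k + c)).
Proof.
apply: (dens_close (slow_cst c)) => n; have := cnt_shift E c n;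
  have := @cnt_mono E n (n + c) (leq_addr _ _); have := cnt_le E c; lia.
Qed.

Lemma dens_bool (b : bool) : dens b 1 (fun=> b).
Proof.
apply: slow_le (slow_cst 0) => n.
by rewrite -[n in cnt _ n]add0n (@cnt_cst _ b) // cnt0; lia.
Qed.

Lemma null_eventually E N : (forall k, N <= k -> ~~ E k) -> null E.
Proof.
move=> h; apply: slow_le (slow_cst N); elim=> [|n IH]; first by rewrite cnt0.
have [nN|Nn] := ltnP n N; first exact: leq_trans (cnt_le _ _) _.
by rewrite cntS (negbTE (h n Nn)) addn0.
Qed.

Lemma dens_eventually (b : bool) E N :
  (forall k, N <= k -> E k = b) -> dens b 1 E.
Proof.
move=> h; apply: dens_null (dens_bool b); apply: (@null_eventually _ N) => k /h->.
by rewrite negbK.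
Qed.

Definition flip (s : nat -> bool) k := s k.+1 != s k.

Definition flip_in (s : nat -> bool) M k :=
  has (fun j => flip s (k + j)) (iota 0 M).

Lemma null_flip_in s M : null (flip s) -> null (flip_in s M).
Proof.
move=> ns; elim: M => [|M IH]; first by apply: null_sub null_xpred0.
apply: null_sub (null_or IH (null_shift M ns)) => k.
by rewrite /flip_in -addn1 iotaD has_cat add0n /= orbF.
Qed.

Lemma no_flip_in s M k : ~~ flip_in s M k ->
  forall j, j <= M -> s (k + j) = s k.
Proof.
move=> /hasPn h; elim=> [|j IH] jM; first by rewrite addn0.
rewrite -IH ?(ltnW jM)// addnS.
by have := h j; rewrite mem_iota /= add0n negbK => /(_ jM)/eqP.
Qed.

(** * Two phase sequences changing only at squares *)

Definition isqrt := Nat.sqrt.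

Lemma isqrtP n : isqrt n * isqrt n <= n < (isqrt n).+1 * (isqrt n).+1.
Proof.
have := PeanoNat.Nat.sqrt_spec' n; rewrite multE.
move=> -[/ssrnat.leP h1 /ssrnat.ltP h2].
by apply/andP.
Qed.

Lemma isqrt_eq n m : m * m <= n < m.+1 * m.+1 -> isqrt n = m.
Proof.
move=> /andP[h1 h2]; apply: PeanoNat.Nat.sqrt_unique.
by rewrite multE; split; [exact/ssrnat.leP|exact/ssrnat.ltP].
Qed.

Lemma isqrt_mono m n : m <= n -> isqrt m <= isqrt n.
Proof.
move=> /ssrnat.leP h; apply/ssrnat.leP.
exact: PeanoNat.Nat.sqrt_le_mono.
Qed.

(** If isqrt n <= K then K * isqrt n <= K^2, and otherwise
    K * isqrt n <= (isqrt n)^2 <= n. *)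
Lemma slow_isqrt : slow isqrt.
Proof.
move=> K; exists (K * K) => n; have /andP[h _] := isqrtP n.
have [k|k] := leqP (isqrt n) K; nia.
Qed.

Lemma null_flip_isqrt (t : nat -> bool) : null (flip (t \o isqrt)).
Proof.
apply: slow_le slow_isqrt; elim=> [|n IH]; first by rewrite cnt0.
rewrite cntS /flip /=; have := isqrt_mono (leqnSn n).
rewrite leq_eqVlt => /predU1P[<-|lt]; first by rewrite eqxx addn0.
by apply: leq_trans lt; rewrite -[(isqrt n).+1]addn1 leq_add ?leq_b1.
Qed.

(** The blocks [(2j)^2, (2j+1)^2) and [(2j+1)^2, (2j+2)^2) carry opposite values
    and their lengths differ by 2, so the discrepancy at time (2j)^2 is at most
    2j; it grows by at most the length of two blocks, which is O(isqrt n), at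
    the other times. *)
Lemma dens_half (t : nat -> bool) (b : bool) :
  (forall j, t (2 * j).+1 = ~~ t (2 * j)) ->
  dens 1 2 (fun k => t (isqrt k) == b).
Proof.
move=> tj; set E := fun k => _.
have block m r : r <= 2 * m + 1 ->
    cnt E (m * m + r) = cnt E (m * m) + r * (t m == b).
  by move=> rm; apply: cnt_cst => k kr; rewrite /E (@isqrt_eq k m)//; lia.
have even j : (2 * cnt E ((2 * j) * (2 * j)) - (2 * j) * (2 * j)) +
    ((2 * j) * (2 * j) - 2 * cnt E ((2 * j) * (2 * j))) <= 2 * j.
  elim: j => [|j IH]; first by rewrite !muln0 cnt0.
  rewrite (_ : 2 * j.+1 * (2 * j.+1) =
    (2 * j).+1 * (2 * j).+1 + (2 * (2 * j).+1 + 1)); last by lia.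
  rewrite block// (_ : (2 * j).+1 * (2 * j).+1 =
    2 * j * (2 * j) + (2 * (2 * j) + 1)); last by lia.
  rewrite block// tj; move: (cnt E _) IH => c IH.
  by case: (t (2 * j)); case: (b) => /=; lia.
apply: slow_le (slow_add (slow_mul 10 slow_isqrt) (slow_cst 4)) => n.
pose j := (isqrt n)./2; have jn : 2 * j <= isqrt n <= (2 * j).+1.
  by rewrite /j; have := odd_double_half (isqrt n); lia.
have n1 : 2 * j * (2 * j) <= n by have := isqrtP n; nia.
have n2 : n <= 2 * j * (2 * j) + 8 * j + 4 by have := isqrtP n; nia.
have := cnt_mono E n1; have := even j; lia.
Qed.

(** Value on the block [m^2, (m+1)^2).  The logarithm does not change between 2j
    and 2j+1, which keeps both sequences balanced, while it makes them agree
    for m in [2^i, 2^(i+1)) with i even and disagree with i odd. *)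
Definition tier (tau : bool) (m : nat) := odd m (+) (tau && odd (trunc_log 2 m)).

Definition phase (tau : bool) (k : nat) := tier tau (isqrt k).

Lemma tier_pair tau j : tier tau (2 * j).+1 = ~~ tier tau (2 * j).
Proof.
rewrite /tier mul2n /= odd_double /=.
suff -> : trunc_log 2 j.*2.+1 = trunc_log 2 j.*2 by [].
case: j => [|j]; first by rewrite trunc_log1 trunc_log0.
apply: trunc_log_eq => //; have := @trunc_logP 2 j.+1.*2 isT isT.
have := @trunc_log_ltn 2 j.+1.*2 isT; rewrite expnS; lia.
Qed.

Lemma null_flip_phase tau : null (flip (phase tau)).
Proof. exact: (null_flip_isqrt (tier tau)). Qed.

Lemma dens_phase tau b : dens 1 2 (fun k => phase tau k == b).
Proof. exact: dens_half (tier_pair tau). Qed.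

Lemma flip_phase_square tau k : flip (phase tau) k ->
  exists m, k.+1 = m * m.
Proof.
rewrite /flip /phase => h; exists (isqrt k.+1).
have ne : isqrt k.+1 != isqrt k by apply: contra h => /eqP->.
have := isqrt_mono (leqnSn k); have := isqrtP k; have := isqrtP k.+1.
nia.
Qed.

Definition phase_lim tau (a : nat -> bool) :=
  forall n, exists i, forall k, k < n -> a k = phase tau (i + k).

Definition phase_type tau (a : nat -> bool) :=
  (exists i, forall k, a k = phase tau (i + k)) \/
  (exists b N, forall k, N <= k -> a k = b).

(** If a is not eventually constant it has two changes, at k1 < k2.  An
    occurrence at position i of a segment containing both puts two squares
    within distance k2 - k1 near i, which bounds i by k2^2.  So all long initial
    segments of a occur at boundedly many positions, one of which serves for all
    of them. *)
Lemma phase_limP tau a : phase_lim tau a -> phase_type tau a.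
Proof.
move=> lim; have [|noconst] := pselect (exists b N, forall k, N <= k -> a k = b).
  by right.
left; have flips N : exists2 k, N <= k & flip a k.
  apply: contra_notP noconst => h; exists (a N), N => k.
  elim: k => [|k IH]; first by rewrite leqn0 => /eqP->.
  rewrite leq_eqVlt => /predU1P[<-//|]; rewrite ltnS => Nk.
  rewrite -(IH Nk); apply/eqP/negPn/negP => f; apply: h; exists k => //.
have [k1 _ f1] := flips 0; have [k2 k12 f2] := flips k1.+1.
have bound i : (forall k, k < k2.+2 -> a k = phase tau (i + k)) -> i <= k2 * k2.
  move=> ai; have flipi k : k <= k2 -> flip a k -> flip (phase tau) (i + k).
    by move=> kk2; rewrite /flip !ai ?addnS//; lia.
  have [m1 e1] := flip_phase_square (flipi _ (ltnW k12) f1).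
  have [m2 e2] := flip_phase_square (flipi _ (leqnn _) f2).
  have m12 : m1 < m2.
    by rewrite ltnNge; apply/negP => m21; have := leq_mul m21 m21; lia.
  have m1k : m1 <= k2.
    by have := leq_mul m12 m12; rewrite mulSn mulnS; lia.
  by have := leq_mul m1k m1k; lia.
apply: contrapT => none.
have bad i : exists k, a k != phase tau (i + k).
  apply: contra_notP none => h; exists i => k.
  by apply/eqP/negPn/negP => ne; apply: h; exists k.
(* A segment longer than all the first witnesses [w i] of failure at the
   admissible positions. *)
pose w i := projT1 (cid (bad i)).
have wP i : a (w i) != phase tau (i + w i) by rewrite /w; case: cid.
pose n := \max_(i < (k2 * k2).+1) w i.
have [i ai] := lim (n + k2.+2).+1.
have ib : i < (k2 * k2).+1 by rewrite ltnS; apply: bound => k kk; apply: ai; lia.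
have := wP i; rewrite ai ?eqxx//.
have := @leq_bigmax _ (fun i : 'I_(k2 * k2).+1 => w i) (Ordinal ib).
rewrite -/n /=; lia.
Qed.

Lemma phase_type_flip tau a : phase_type tau a -> null (flip a).
Proof.
move=> [[i ai]|[b [N aN]]].
  apply: null_sub (null_shift i (null_flip_phase tau)) => k.
  by rewrite /flip !ai addnS [k + i]addnC.
apply: (@null_eventually _ N) => k Nk.
by rewrite /flip !aN ?eqxx// leqW.
Qed.

Lemma phase_type_dens tau a a' : phase_type tau a -> phase_type tau a' ->
  exists p q, 0 < q /\ dens p q (fun k => a k == a' k).
Proof.
have mixed (a1 a2 : nat -> bool) :
    (exists i, forall k, a1 k = phase tau (i + k)) ->
    (exists b N, forall k, N <= k -> a2 k = b) ->
    dens 1 2 (fun k => a1 k == a2 k).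
  move=> [i ai] [b [N aN]].
  apply: dens_null (dens_shift i (dens_phase tau b)).
  by apply: (@null_eventually _ N) => k Nk; rewrite ai aN// [i + k]addnC eqxx.
move=> [h|h] [h'|h'].
- exists 1, 1; split=> //; apply: (dens_null _ (dens_bool true)).
  case: h h' => [i ai] [i' ai'].
  have nf := null_flip_in (maxn i i') (null_flip_phase tau).
  apply: null_sub nf => k; apply: contraR => nof.
  suff -> : a k = a' k by rewrite eqxx.
  by rewrite ai ai' ![_ + k]addnC !(no_flip_in nof) ?leq_maxl ?leq_maxr.
- by exists 1, 2; split=> //; exact: mixed.
- exists 1, 2; split=> //.
  have -> : (fun k => a k == a' k) = (fun k => a' k == a k).
    by apply/funext => k; rewrite eq_sym.
  exact: mixed.
- case: h h' => [b [N aN]] [b' [N' aN']].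
  exists (b == b'), 1; split=> //; apply: (@dens_eventually _ _ (maxn N N')) => k.
  by rewrite geq_max => /andP[k1 k2]; rewrite aN// aN'.
Qed.

Lemma phase_agree i k : 4 ^ i <= k < 4 ^ i.+1 ->
  (phase false k == phase true k) = ~~ odd i.
Proof.
move=> ki; rewrite /phase /tier /= addbF.
have -> : trunc_log 2 (isqrt k) = i.
  apply: trunc_log_eq => //; have := isqrtP k; move: ki.
  rewrite (_ : 4 = 2 * 2)// !expnMn; nia.
by case: (odd (isqrt k)); case: (odd i).
Qed.

Lemma cnt_agree_even i : ~~ odd i ->
  3 * 4 ^ i <= cnt (fun k => phase false k == phase true k) (4 ^ i.+1).
Proof.
move=> oi; rewrite (_ : 4 ^ i.+1 = 4 ^ i + 3 * 4 ^ i); last by rewrite expnS; lia.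
rewrite (@cnt_cst _ true); first by lia.
by move=> k ki; rewrite (@phase_agree i) ?oi// expnS; lia.
Qed.

Lemma cnt_agree_odd i : odd i ->
  cnt (fun k => phase false k == phase true k) (4 ^ i.+1) <= 4 ^ i.
Proof.
move=> oi; rewrite (_ : 4 ^ i.+1 = 4 ^ i + 3 * 4 ^ i); last by rewrite expnS; lia.
rewrite (@cnt_cst _ false) ?muln0 ?addn0 ?cnt_le//.
by move=> k ki; rewrite (@phase_agree i) ?oi// expnS; lia.
Qed.

End Slow.

(** * Frequencies and their limits *)

Section Freq.
Variable R : realType.

Lemma freqE (X : metricType R) (f : X -> X) x y (delta : R) n :
  close_freq f x y delta n =
  (cnt (fun k => mdist (iter k f x) (iter k f y) < delta) n.+1)%:R / n%:R.
Proof.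
by rewrite /close_freq /cnt -sum1_card big_mkcond.
Qed.

Lemma dens_cvg p q (E : pred nat) : (0 < q)%N -> dens p q E ->
  ((cnt E n.+1)%:R / n%:R : R) @[n --> \oo] --> (p%:R / q%:R : R).
Proof.
move=> q0 dE; apply/cvgrPdist_lt => e e0.
have [K K0 Ke] : exists2 K, (0 < K)%N & 2 / e < K%:R :> R.
  by exists (Num.trunc (2 / e)).+1 => //; rewrite truncnS_gt.
have [C HC] := dE K.
exists (C + K * p).+2 => // n /= nC.
have n0 : 0 < n%:R :> R by rewrite ltr0n; lia.
have q0' : 0 < q%:R :> R by rewrite ltr0n.
have q1 : 1 <= q%:R :> R by rewrite ler1n.
(* The count runs over n + 1 indices but is divided by n: the discrepancy is
   absorbed by C and by K * p, hence by n since n is large. *)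
have e1 : (K * (q * cnt E n.+1) <= K * (p * n) + (n + n))%N.
  by have := HC n.+1; rewrite !mulnDr !mulnBr !mulnS !mulnDr; lia.
have e2 : (K * (p * n) <= K * (q * cnt E n.+1) + (n + n))%N.
  by have := HC n.+1; rewrite !mulnDr !mulnBr !mulnS !mulnDr; lia.
have k0 : 0 < K%:R :> R by rewrite ltr0n.
have ke2 : 2 < K%:R * e by rewrite -ltr_pdivrMr.
move: e1 e2; rewrite -!(ler_nat R) !natrD !natrM.
move: (cnt E n.+1)%:R (K%:R) k0 {Ke} ke2 => c k k0 ke2 e1 e2.
have -> : p%:R / q%:R - c / n%:R = (p%:R * n%:R - q%:R * c) / (q%:R * n%:R).
  by field; rewrite !gt_eqF.
rewrite normrM normfV (ger0_norm (mulr_ge0 (ltW q0') (ltW n0))).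
rewrite ltr_pdivrMr ?mulr_gt0//.
rewrite -(ltr_pM2l k0); apply: (@le_lt_trans _ _ (2 * n%:R)).
  rewrite -[X in X * _](gtr0_norm k0) -normrM ler_norml.
  by apply/andP; split; rewrite mulrBr; lra.
rewrite mulrA; apply: (@lt_le_trans _ _ (k * e * n%:R)); first by rewrite ltr_pM2r.
rewrite ler_wpM2l//; first by rewrite mulr_ge0 ?ltW.
by rewrite ler_peMl// ltW.
Qed.

Lemma dens_Phi (X : metricType R) (f : X -> X) x y (delta : R) p q :
  (0 < q)%N -> dens p q (fun k => mdist (iter k f x) (iter k f y) < delta) ->
  Phi f x y delta = p%:R / q%:R /\ Phi_star f x y delta = p%:R / q%:R.
Proof.
move=> q0 /(dens_cvg q0) h; rewrite /Phi /Phi_star.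
have -> : close_freq f x y delta = (fun n =>
  (cnt (fun k => mdist (iter k f x) (iter k f y) < delta) n.+1)%:R / n%:R).
  by apply/funext => n; exact: freqE.
by have [-> ->] := cvg_limn_inf_sup h.
Qed.

Lemma cnt_ratio_bound (E : pred nat) n :
  0 <= ((cnt E n.+1)%:R / n%:R : R) <= 2.
Proof.
rewrite divr_ge0//=; case: n => [|n]; first by rewrite invr0 mulr0.
by rewrite ler_pdivrMr// -natrM ler_nat; have := cnt_le E n.+2; lia.
Qed.

Lemma limn_inf_lt_sup (u : R^nat) (a b : R) :
  (forall n, 0 <= u n <= 2) -> a < b ->
  (forall N, exists2 n, (N <= n)%N & u n <= a) ->
  (forall N, exists2 n, (N <= n)%N & b <= u n) ->
  limn_inf u < limn_sup u.
Proof.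
move=> u02 ab ua ub.
have lb : has_lbound (range u).
  by exists 0 => _ [n _ <-]; case/andP: (u02 n).
have hb : has_ubound (range u).
  by exists 2 => _ [n _ <-]; case/andP: (u02 n).
apply: (@le_lt_trans _ _ a).
  apply: limr_le; first by apply/cvg_ex; eexists; exact: cvg_infs_sup.
  apply: nearW => N; have [n Nn una] := ua N; apply: le_trans una.
  by apply: ge_inf; [apply: has_lbound_sdrop|exists n].
apply: lt_le_trans ab _.
apply: limr_ge; first by apply/cvg_ex; eexists; exact: cvg_sups_inf.
apply: nearW => N; have [n Nn una] := ub N; apply: le_trans una _.
by apply: ub_le_sup; [apply: has_ubound_sdrop|exists n].
Qed.

End Freq.

(** * The shift by two letters *)

Section Example.
Variable R : realType.

(** Even letters carry the phase, odd letters the type. *)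
Definition code (tau : bool) (a : nat -> bool) (n : nat) : bool :=
  if odd n then tau else a n./2.

Lemma code_shift tau a n : code tau a n.+2 = code tau (fun k => a k.+1) n.
Proof. by rewrite /code /= negbK. Qed.

Definition words : set (nat -> bool) :=
  [set w | exists tau i, w = code tau (fun k => phase tau (i + k))].

Notation X := (wtree R words).
Implicit Types u v : X.

Lemma shift_on_tree v : on_tree words (fun n => v n.+2).
Proof.
split=> [n|n /coord_full|n]; [exact: coord_le1|exact|].
case: (coordP v) => _ _ /(_ n.+2)[_ [tau [i ->]] vw].
exists (code tau (fun k => phase tau (i.+1 + k))); first by exists tau, i.+1.
move=> k kn; have := vw k.+2; rewrite code_shift.
by under eq_fun do rewrite addnS -addSn; exact.
Qed.

Definition shift v : X := WTree (shift_on_tree v).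

Lemma iter_shift k v n : iter k shift v n = v (n + k.*2)%N.
Proof.
elim: k n => [|k IH] n /=; first by rewrite addn0.
by rewrite IH doubleS !addnS.
Qed.

Lemma shift_continuous : continuous shift.
Proof. by apply: wtree_continuous => k; exact: wcoord_continuous. Qed.

Lemma words_neq0 : words !=set0.
Proof. by exists (code false (fun k => phase false (0 + k))), false, 0%N. Qed.

Lemma sign_eq1 (x : R) (b : bool) :
  `|x| = 1 -> 0 <= x * (-1) ^+ b -> x = (-1) ^+ b.
Proof.
case: b => /=; rewrite ?expr1 ?expr0 => x1 x0.
  by rewrite ler0_norm in x1; lra.
by rewrite ger0_norm in x1; lra.
Qed.

Lemma norm_code tau a n : `|(-1) ^+ code tau a n : R| = 1.
Proof. by rewrite normrX normrN1 expr1n. Qed.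

(** An end is a limit of words of W, so its type is constant and its phases are
    limits of phase sequences; any other point has only finitely many nonzero
    coordinates. *)
Lemma leaf_or_finite v :
  (exists N, forall k, (N <= k)%N -> v k = 0) \/
  (exists tau a, phase_type tau a /\ forall n, v n = (-1) ^+ code tau a n).
Proof.
have [|full] := pselect (exists j, `|v j| != 1).
  by move=> [j vj]; left; exists j.+1 => k jk; exact: coord_end jk.
have v1 n : `|v n| = 1.
  by apply/eqP/negPn/negP => ne; apply: full; exists n.
right; pose sg n := v n == -1.
have sgE n (b : bool) : v n = (-1) ^+ b -> b = sg n.
  rewrite /sg => ->; case: b => /=; rewrite ?expr1 ?expr0 ?eqxx//.
  by rewrite eq_sym lt_eqF//; lra.
have word n : exists tau i, forall k, (k < n)%N ->
    v k = (-1) ^+ code tau (fun k => phase tau (i + k)) k.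
  case: (coordP v) => _ _ /(_ n)[_ [tau [i ->]] vw]; exists tau, i => k kn.
  by apply: sign_eq1 => //; exact: vw.
exists (sg 1%N), (fun k => sg k.*2); split.
  apply: phase_limP => n; have [tau [i wi]] := word n.*2.+2; exists i => k kn.
  have /sgE <- : v 1%N = (-1) ^+ tau by rewrite wi.
  have /sgE <- // : v k.*2 = (-1) ^+ phase tau (i + k).
  by rewrite wi ?/code ?odd_double ?doubleK//; lia.
move=> n; have [tau [i wi]] := word n.+2; rewrite wi; last by lia.
have /sgE <- : v 1%N = (-1) ^+ tau by rewrite wi.
rewrite /code; case: ifP => // /negbT on.
congr (_ ^+ _); congr nat_of_bool; apply: sgE; rewrite even_halfK//.
rewrite wi; last by lia.
by rewrite /code (negbTE on).
Qed.

Lemma coord_dist k u v : wt R k * `|u k - v k| <= mdist u v.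
Proof. exact: coord_le_wdist. Qed.

Lemma head_dist u v : `|u 0%N - v 0%N| <= mdist u v.
Proof. by have := coord_dist 0 u v; rewrite /wt expr0 mul1r. Qed.

Lemma dist_sign (b c : bool) : b != c -> `|(-1) ^+ b - (-1) ^+ c : R| = 2.
Proof.
by case: b; case: c => //= _; rewrite ?expr1 ?expr0;
  [rewrite ltr0_norm|rewrite gtr0_norm]; lra.
Qed.

Lemma leaf_orbit tau a v k n : (forall n, v n = (-1) ^+ code tau a n) ->
  iter k shift v n = (-1) ^+ code tau (fun j => a (j + k)%N) n.
Proof.
move=> va; rewrite iter_shift va /code oddD odd_double addbF.
by case: ifP => // on; rewrite halfD odd_double andbF add0n doubleK.
Qed.

(** For delta < 1, closeness at time k forces equality of type and of the
    phases at time k; conversely equality of the phases at time k propagates to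
    a whole window [k, k + N), hence gives closeness, unless one of the two
    sequences changes in that window. *)
Lemma close_dens u v (delta : R) : 0 < delta < 1 -> exists p q, (0 < q)%N /\
  dens p q (fun k => mdist (iter k shift u) (iter k shift v) < delta).
Proof.
move=> /andP[d0 d1].
have far u' v' N tau a : (forall k, (N <= k)%N -> u' k = 0) ->
    (forall n, v' n = (-1) ^+ code tau a n) -> forall k, (N <= k)%N ->
    1 <= mdist (iter k shift u') (iter k shift v').
  move=> uN va k Nk; apply: le_trans (head_dist _ _).
  rewrite (leaf_orbit _ _ va) iter_shift uN ?sub0r ?normrN ?norm_code//.
  by rewrite add0n -addnn; lia.
have [[N uN]|[tau [a [pa ua]]]] := leaf_or_finite u;
  have [[M vM]|[tau' [a' [pa' va']]]] := leaf_or_finite v.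
- exists true, 1%N; split=> //; apply: (@dens_eventually true _ (maxn N M)) => k.
  rewrite geq_max => /andP[Nk Mk].
  have -> : iter k shift u = iter k shift v.
    by apply: wtree_ext => n; rewrite !iter_shift uN ?vM//; lia.
  by rewrite mdistxx.
- exists false, 1%N; split=> //; apply: (@dens_eventually false _ N) => k Nk.
  by apply/negbTE; rewrite -leNgt (le_trans (ltW d1))// (far _ _ _ _ _ uN va').
- exists false, 1%N; split=> //; apply: (@dens_eventually false _ M) => k Mk.
  apply/negbTE; rewrite -leNgt (le_trans (ltW d1))// metric_sym.
  exact: (far _ _ _ _ _ vM ua).
have [tt|tt] := eqVneq tau tau'; last first.
  exists false, 1%N; split=> //; apply: (@dens_eventually false _ 0) => k _.
  apply/negbTE; rewrite -leNgt (le_trans (ltW d1))//.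
  apply: le_trans (coord_dist 1 _ _).
  rewrite (leaf_orbit _ _ ua) (leaf_orbit _ _ va') dist_sign// /wt expr1.
  by rewrite mulVf.
rewrite -{}tt in pa' va'.
have [p [q [q0 dpq]]] := phase_type_dens pa pa'.
exists p, q; split=> //; apply: dens_null dpq.
have [N close] := wdist_lt_box words d0.
have nf := null_or (null_flip_in N (phase_type_flip pa))
                   (null_flip_in N (phase_type_flip pa')).
apply: null_sub nf => k; apply: contraR; rewrite negb_or => /andP[nf nf'].
apply/eqP/esym; have [aa|aa] := eqVneq (a k) (a' k).
  apply: close => n nN; rewrite (leaf_orbit _ _ ua) (leaf_orbit _ _ va').
  suff -> : code tau (fun j => a (j + k)%N) n = code tau (fun j => a' (j + k)%N) n.
    by rewrite subrr normr0 divr_gt0.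
  rewrite /code; case: ifP => //= _; rewrite ![(n./2 + k)%N]addnC.
  by rewrite (no_flip_in nf) ?(no_flip_in nf') ?aa//; lia.
apply/negbTE; rewrite -leNgt; apply: le_trans (head_dist _ _).
rewrite (leaf_orbit _ _ ua) (leaf_orbit _ _ va') dist_sign//=; lra.
Qed.

Lemma leaf_on_tree (tau : bool) :
  on_tree words (fun n => (-1) ^+ code tau (phase tau) n : R).
Proof.
split=> [n|n _|n]; [by rewrite norm_code|exact: norm_code|].
exists (code tau (phase tau)); first by exists tau, 0%N.
by move=> k _; rewrite -expr2 sqr_ge0.
Qed.

Definition leaf tau : X := WTree (leaf_on_tree tau).

Lemma dist_le2 u v : mdist u v <= 2.
Proof.
apply: wdist_le => k; apply: le_trans (wt_diff_le2 u v k) _.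
by rewrite -[leRHS]mul1r ler_wpM2r// (wt_mono R (leq0n k)).
Qed.

(** The second letters always differ, which contributes distance 2 / 2 = 1; the
    first letters contribute 0 or 2. *)
Lemma leaf_agree (delta : R) k : 1 < delta < 2 ->
  (mdist (iter k shift (leaf false)) (iter k shift (leaf true)) < delta) =
  (phase false k == phase true k).
Proof.
move=> /andP[d1 d2].
have lE tau n :=
  @leaf_orbit tau (phase tau) (leaf tau) k n (fun=> erefl).
have [pp|pp] := eqVneq (phase false k) (phase true k); last first.
  apply/negbTE; rewrite -leNgt (le_trans (ltW d2))//.
  by apply: le_trans (head_dist _ _); rewrite !lE dist_sign.
apply: le_lt_trans d1; apply: wdist_le => -[|n].
  by rewrite !lE /code /= add0n pp subrr normr0 mulr0 ler01.
apply: le_trans (wt_diff_le2 _ _ _) _.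
have := wt_mono R (ltn0Sn n); rewrite /wt expr1; lra.
Qed.

Lemma diam_ge2 : 2 <= diam X.
Proof.
apply: (@le_trans _ _ (mdist (leaf false) (shift (leaf false)))).
  apply: le_trans (head_dist _ _).
  rewrite -[leaf false 0%N]/((-1) ^+ false).
  by rewrite -[shift (leaf false) 0%N]/((-1) ^+ true) dist_sign.
apply: ub_le_sup; last by exists (leaf false, shift (leaf false)).
by exists 2 => _ [[u v] _ <-]; exact: dist_le2.
Qed.

Lemma leaf_DC3 : DC3_pair shift (leaf false) (leaf true).
Proof.
exists 1, 2; split; [exact: ler01|lra|exact: diam_ge2|move=> delta d12].
pose E := fun k => phase false k == phase true k.
rewrite /Phi /Phi_star.
have -> : close_freq shift (leaf false) (leaf true) delta =
    fun n => (cnt E n.+1)%:R / n%:R.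
  apply/funext => n; rewrite freqE; congr (_%:R / _).
  by apply: eq_bigr => k _; rewrite leaf_agree.
(* The blocks [4^i, 4^(i+1)) end at the last index 4^(i+1) - 1; the frequency
   there is at most 1/3 for odd i and at least 3/4 for even i. *)
have grow N i : (N <= i)%N -> (N <= (4 ^ i.+1).-1)%N.
  by have := ltn_expl i.+1 (isT : (1 < 4)%N); lia.
have pos i : 0 < ((4 ^ i.+1).-1)%:R :> R.
  by rewrite ltr0n; have := ltn_expl i.+1 (isT : (1 < 4)%N); lia.
have pred4 i : (4 ^ i.+1).-1.+1 = (4 ^ i.+1)%N by rewrite prednK// expn_gt0.
apply: (@limn_inf_lt_sup _ _ (1 / 3) (3 / 4)); first exact: cnt_ratio_bound.
- lra.
- move=> N; have [i Ni oi] : exists2 i, (N <= i)%N & odd i.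
    by exists N.*2.+1; [lia|rewrite /= odd_double].
  exists (4 ^ i.+1).-1; first exact: grow.
  rewrite pred4 ler_pdivrMr// mulrAC mul1r ler_pdivlMr// -natrM ler_nat.
  have := cnt_agree_odd oi; have : (0 < 4 ^ i)%N by rewrite expn_gt0.
  by rewrite -/E !expnS; lia.
- move=> N; have [i Ni oi] : exists2 i, (N <= i)%N & ~~ odd i.
    by exists N.*2; [lia|rewrite odd_double].
  exists (4 ^ i.+1).-1; first exact: grow.
  rewrite pred4 ler_pdivlMr// mulrAC ler_pdivrMr// -!natrM ler_nat.
  have := cnt_agree_even oi; rewrite -/E !expnS; lia.
Qed.

Lemma Phi_eq u v (delta : R) : 0 < delta < 1 ->
  Phi shift u v delta = Phi_star shift u v delta.
Proof.
by move=> /(close_dens u v)[p [q [q0]]] /(dens_Phi q0)[-> ->].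
Qed.

Lemma no_DC2h u v : ~ DC2h_pair shift u v.
Proof.
rewrite /DC2h_pair /Phi0 /Phi_star0.
have near_eq : \forall delta \near 0^'+,
    Phi shift u v delta = Phi_star shift u v delta.
  near=> delta; apply: Phi_eq; apply/andP; split; near: delta.
    exact: nbhs_right_gt.
  exact: nbhs_right_lt.
suff -> : Phi shift u v delta @[delta --> 0^'+] =
          Phi_star shift u v delta @[delta --> 0^'+] by rewrite ltxx.
apply/seteqP; split=> A; rewrite /nbhs/=; apply: filterS2 near_eq => d /=;
  by move=> ->.
Unshelve. all: by end_near. Qed.

(** Upper frequency 1 at distance 1/2 means density 1 of the times with distance
    < 1/2, hence density 1 for all larger distances as well; below 1/2 the two
    frequencies coincide anyway. *)
Lemma no_DC2 u v : ~ DC2_pair shift u v.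
Proof.
move=> [star [e /andP[e0 ed] Phie]].
have h : 0 < (2^-1 : R) < 1 by apply/andP; split; lra.
have [p [q [q0 dpq]]] := close_dens u v h.
have pq1 : p%:R / q%:R = 1 :> R.
  have [_ <-] := dens_Phi q0 dpq; apply: star.
  by have := diam_ge2; lra.
have pq : p = q.
  by apply/eqP; rewrite -(eqr_nat R); apply/eqP; apply: divr1_eq.
subst p.
have [elt|ege] := ltP e 2^-1.
  suff : Phi shift u v e = 1 by move: Phie => /[swap] ->; rewrite ltxx.
  by rewrite Phi_eq ?e0 ?(lt_trans elt)//; [apply: star; rewrite e0|lra].
have [Phi1 _] : Phi shift u v e = q%:R / q%:R /\
    Phi_star shift u v e = q%:R / q%:R.
  apply: dens_Phi => //; apply: slow_le dpq => n.
  have := cnt_le (fun k => mdist (iter k shift u) (iter k shift v) < e) n.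
  have := @cnt_sub (fun k => mdist (iter k shift u) (iter k shift v) < 2^-1)
    (fun k => mdist (iter k shift u) (iter k shift v) < e) n
    (fun k h => lt_le_trans h ege).
  move: (cnt _ n) (cnt _ n) => c c' cc' c'n.
  by rewrite -!mulnBr -!mulnDr leq_mul2l; apply/orP; right; lia.
by move: Phie; rewrite Phi1 pq1 ltxx.
Qed.

End Example.

Theorem theorem4 (R : realType) :
  (exists (X : metricType R) (f : X -> X),
    [/\ dendrite X, continuous f,
        (exists x y : X, DC3_pair f x y)
      & ~ (exists x y : X, DC2_pair f x y)]) /\
  (exists (X : metricType R) (f : X -> X),
    [/\ dendrite X, continuous f,
        (exists x y : X, DC3_pair f x y)
      & ~ (exists x y : X, DC2h_pair f x y)]).
Proof.
have dX : dendrite (wtree R words) by exact/wtree_dendrite/words_neq0.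
have cf : continuous (@shift R) by exact: shift_continuous.
have dc3 : exists x y, DC3_pair (@shift R) x y.
  by exists (leaf R false), (leaf R true); exact: leaf_DC3.
split; exists (wtree R words), (@shift R); split=> // -[x [y]].
  exact: no_DC2.
exact: no_DC2h.
Qed.
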